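(* There is a partition $\{B_\xi:\xi<\mathfrak c\}$ of $\mathbb R$ into Bernstein sets such that for every $\xi<\mathfrak c$ the set $B_\xi$ is a ${<}\operatorname{cf}(\mathfrak c)$-covering.
   Context: $\mathfrak c=|\mathbb R|$ and $\operatorname{cf}$ denotes cofinality. A set $B\subseteq\mathbb R$ is a Bernstein set if for every uncountable Borel set $Z\subseteq\mathbb R$ both $Z\cap B$ and $Z\setminus B$ are nonempty. A set $A\subseteq\mathbb R$ is a ${<}\kappa$-covering if for every $B\subseteq\mathbb R$ with $|B|<\kappa$ there is $x\in\mathbb R$ with $B+x\subseteq A$. *)

(* Defs.v *)
From HB Require Import structures.
From mathcomp Require Import all_boot all_order all_algebra.
From mathcomp Require Import all_classical all_reals all_analysis.
Set Implicit Arguments. Unset Strict Implicit. Unset Printing Implicit Defensive.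
Import Order.TTheory GRing.Theory Num.Theory.
Local Open Scope classical_set_scope.
Local Open Scope ring_scope.
Local Open Scope card_scope.

(* A strict well-ordering of R of order type c (= an initial ordinal):
   every proper initial segment has cardinality strictly less than |R|. *)
Definition initial_ordering (R : realType) (lt : R -> R -> Prop) : Prop :=
  (forall x, ~ lt x x) /\
  (forall x y z, lt x y -> lt y z -> lt x z) /\
  (forall x y, x <> y -> lt x y \/ lt y x) /\
  well_founded lt /\
  (forall x, ~ ([set: R] #<= [set y | lt y x])).

(* |S| < cf(c): every subset of R of cardinality <= |S| is bounded in an
   initial-ordinal ordering of R (of order type c).  cf(c) is the least
   cardinality of an unbounded subset; this does not depend on the choice of
   the ordering, so we quantify over all of them. *)
Definition lt_cf_c (R : realType) (S : set R) : Prop :=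
  forall lt : R -> R -> Prop, initial_ordering lt ->
  forall X : set R, X #<= S -> exists x : R, forall y, X y -> lt y x.

Definition Bernstein (R : realType) (B : set R) : Prop :=
  forall Z : set R, measurable Z -> ~ countable Z ->
    (Z `&` B) !=set0 /\ (Z `\` B) !=set0.

Definition lt_cf_covering (R : realType) (A : set R) : Prop :=
  forall B : set R, lt_cf_c B -> exists x : R, [set b + x | b in B] `<=` A.

(* Main.v *)
Require Import Defs.
From HB Require Import structures.
From mathcomp Require Import all_boot all_order all_algebra.
From mathcomp Require Import all_classical all_reals all_analysis.
From mathcomp Require Import lra.
Local Open Scope classical_set_scope.
Local Open Scope ring_scope.
Import Order.TTheory GRing.Theory Num.Theory.
Import numFieldNormedType.Exports.

(* There may be more than c sets of cardinality < cf(c), but each of them lies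
   in an initial segment I_g of a fixed ordering of R of type c, so it is enough
   to place a translate of every I_g, for c many g, in every block.  Stage g of a
   recursion of length c chooses a translate of I_g and a point of K_g, disjoint
   from everything chosen before, and gives them to the block xi_g; here (xi, K)
   runs cofinally often through all pairs of an index and a perfect set.  Before
   stage g fewer than c points are taken, because |I x I| < c for |I| < c, so the
   choice is possible.  Every uncountable Borel set Z contains one of the c many
   perfect sets: Z is analytic, and a scheme of shrinking rational intervals
   with uncountable analytic traces embeds the Cantor space in Z. *)

(** * Cardinal arithmetic and well-orderings *)

(** Choice picks a partner in [B] for each point of [A], and the second condition makes the choice
    injective. Working with a relation spares naming the function. *)
Lemma card_le_rel {T U : Type} {A : set T} {B : set U} (r : T -> U -> Prop) :
    (forall x, A x -> exists2 y, B y & r x y) ->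
    (forall x x' y, A x -> A x' -> r x y -> r x' y -> x = x') ->
  (A #<= B)%card.
Proof.
move=> tot inj.
have /choice[f fP] : forall x : A, exists y : B, r (val x) (val y).
  move=> x; have [|y By rxy] := tot (val x); first exact: set_valP.
  by exists (exist _ y (mem_set By)).
apply/card_leP/injfunPex; exists f => // x x' _ _ fxx'.
apply: val_inj; apply: (inj _ _ (val (f x))); try exact: set_valP.
  exact: fP.
by rewrite fxx'; exact: fP.
Qed.

Lemma card_le_inj {T U : Type} {A : set T} {B : set U} (f : T -> U) :
  (forall x, A x -> B (f x)) -> set_inj A f -> (A #<= B)%card.
Proof.
move=> fAB finj; apply: (card_le_rel (fun x y => y = f x)) => [x Ax|x x' y Ax Ax' -> e].
  by exists (f x) => //; exact: fAB.
by apply: finj; rewrite ?inE.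
Qed.

Lemma card_le_fun {T : Type} {U : pointedType} {A : set T} {B : set U} :
  (A #<= B)%card -> exists2 f : T -> U, (forall x, A x -> B (f x)) & set_inj A f.
Proof. by move=> /pcard_leP/injfunPex[f fAB finj]; exists f. Qed.

Lemma card_le_setX {T T' U U' : pointedType} {A : set T} {A' : set T'}
    {B : set U} {B' : set U'} :
  (A #<= A')%card -> (B #<= B')%card -> (A `*` B #<= A' `*` B')%card.
Proof.
move=> /card_le_fun[f fA fi] /card_le_fun[g gB gi].
apply: (card_le_inj (fun p => (f p.1, g p.2))) => [[x y] /= [Ax By]|].
  by split; [exact: fA|exact: gB].
move=> [x y] [x' y'] /set_mem[/= Ax By] /set_mem[/= Ax' By'] [e1 e2].
by congr (_, _); [apply: fi|apply: gi]; rewrite ?inE.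
Qed.

(** Zorn on graphs of partial injections from [A] to [B]. A maximal graph has domain [A] or range
    [B], since otherwise a pair of missed points could be added. *)
Lemma card_le_total {T U : Type} (A : set T) (B : set U) :
  (A #<= B)%card \/ (B #<= A)%card.
Proof.
pose P (G : set (T * U)) := forall p q, G p -> G q ->
  [/\ A p.1, B p.2 & p.1 = q.1 <-> p.2 = q.2].
have [F FP Ftot|G [PG maxG]] := @Zorn_bigcup _ P.
  move=> p q [X FX Xp] [Y FY Yq].
  have [XY|YX] := Ftot _ _ FX FY.
    by apply: (FP _ FY) => //; exact: XY.
  by apply: (FP _ FX) => //; exact: YX.
have [domA|] := pselect (forall x, A x -> exists y, G (x, y)).
  left; apply: (card_le_rel (fun x y => G (x, y))) => [x /domA[y Gxy]|x x' y _ _ Gx Gx'].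
    by exists y => //; have [] := PG _ _ Gxy Gxy.
  by have [_ _ [_]] := PG _ _ Gx Gx'; exact.
move=> /existsNP[a /not_implyP[Aa /forallNP aG]].
right; apply: (card_le_rel (fun y x => G (x, y))) => [y By|y y' x _ _ Gx Gx']; last first.
  by have [_ _ [+ _]] := PG _ _ Gx Gx'; exact.
apply: contrapT => yG.
have {}yG x : ~ G (x, y).
  by move=> Gxy; apply: yG; exists x => //; have [] := PG _ _ Gxy Gxy.
apply: (maxG (G `|` [set (a, y)])).
  by split; [exact: subsetUl|move=> /(_ (a, y) (or_intror erefl)); exact: aG].
move=> p q [Gp|->] [Gq|->] /=.
- exact: PG.
- have [Ap Bp _] := PG _ _ Gp Gp; split=> //; case: p Gp {Ap Bp} => u v /= Gp.
  by split=> e; move: Gp; rewrite e => Gp; [case: (aG v)|case: (yG u)].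
- have [Ap Bp _] := PG _ _ Gq Gq; split=> //; case: q Gq {Ap Bp} => u v /= Gp.
  by split=> e; move: Gp; rewrite -e => Gp; [case: (aG v)|case: (yG u)].
- by [].
Qed.

(* Zorn on the graphs G of injections D * D -> D with D included in A.  If
   |D| < |A| for a maximal G, a copy e(D) of D outside D receives the three
   missing rectangles of (D + e(D))^2. *)
Lemma card_le_infinite_setX {T : pointedType} (A : set T) :
  infinite_set A -> (A `*` A #<= A)%card.
Proof.
move=> /infiniteP/card_le_fun[f fA finj].
have {}finj i j : f i = f j -> i = j by apply: finj; rewrite ?inE.
pose D (G : set (T * T * T)) d := exists t, G (d, d, t).
pose G0 : set (T * T * T) :=
  [set (f n.1, f n.2, f (pickle n)) | n in [set: nat * nat]].
(* The last clause is conditional on [G] having an element because Zorn's lemma also asks about the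
   empty chain. It makes [D G] contain the range of [f] once [G] is nonempty. *)
pose P G := [/\ forall p q, G p -> G q -> (p.1 = q.1 <-> p.2 = q.2),
  forall a b t, G (a, b, t) -> [/\ D G a, D G b, D G t & A a],
  forall a b, D G a -> D G b -> exists t, G (a, b, t) &
  forall p, G p -> G0 `<=` G].
have [F FP Ftot|G [[Ginj Gdom Gtot G0G] maxG]] := @Zorn_bigcup _ P.
  have DU X d : F X -> D X d -> D (\bigcup_(X in F) X) d.
    by move=> FX [t Xt]; exists t; exists X.
  split.
  - move=> p q [X FX Xp] [Y FY Yq].
    have [XY|YX] := Ftot _ _ FX FY.
      by have [+ _ _ _] := FP _ FY; apply => //; exact: XY.
    by have [+ _ _ _] := FP _ FX; apply => //; exact: YX.
  - move=> a b t [X FX Xp]; have [_ /(_ _ _ _ Xp)[Da Db Dt Aa] _ _] := FP _ FX.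
    by split=> //; exact: (DU X).
  - move=> a b [t [X FX Xa]] [u [Y FY Yb]].
    have [XY|YX] := Ftot _ _ FX FY.
      have [_ _ /(_ a b) + _] := FP _ FY; case=> [||v Yv]; last by exists v; exists Y.
        by exists t; exact: XY.
      by exists u.
    have [_ _ /(_ a b) + _] := FP _ FX; case=> [||v Xv]; last by exists v; exists X.
      by exists t.
    by exists u; exact: YX.
  - move=> p [X FX Xp] q G0q; exists X => //.
    by have [_ _ _ /(_ _ Xp)] := FP _ FX; exact.
have G0D i : D G0 (f i) by exists (f (pickle (i, i))); exists (i, i).
have {}G0G : G0 `<=` G.
  have [[p Gp]|/forallNP G0'] := pselect (exists p, G p); first exact: G0G Gp.
  exfalso; apply: (maxG G0).
    split=> [p /G0'//|].
    move=> /(_ (f 0%N, f 0%N, f (pickle (0, 0)%N))) G0f.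
    by apply: G0'; apply: G0f; exists (0, 0)%N.
  split.
  - move=> _ _ [[i j] _ <-] [[i' j'] _ <-] /=; split.
      by move=> [/finj -> /finj ->].
    by move=> /finj/(pcan_inj pickleK)[-> ->].
  - by move=> _ _ _ [[i j] _ [<- <- <-]]; split=> //; exact: fA.
  - move=> _ _ [_ [[i i'] _ [<- _ _]]] [_ [[j j'] _ [<- _ _]]].
    by exists (f (pickle (i, j))); exists (i, j).
  - by move=> p _ q.
have fD i : D G (f i) by have [t /G0G] := G0D i; exists t.
have DA : D G `<=` A by move=> d [t /Gdom[]].
have /card_le_fun[k kD kinj] : (D G `*` D G #<= D G)%card.
  apply: (card_le_rel (fun p t => G (p, t))) => [[a b] [/= Da Db]|p q t _ _ Gp Gq].
    by have [t Gt] := Gtot _ _ Da Db; exists t => //; have [] := Gdom _ _ _ Gt.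
  by have [_] := Ginj _ _ Gp Gq; exact.
have {}kinj a b a' b' : D G a -> D G b -> D G a' -> D G b' ->
    k (a, b) = k (a', b') -> a = a' /\ b = b'.
  by move=> Da Db Da' Db' /kinj; rewrite !inE => /(_ (conj Da Db) (conj Da' Db'))[].
have {}kD a b : D G a -> D G b -> D G (k (a, b)) by move=> Da Db; exact: kD.
have DDD : (D G `*` D G #<= D G)%card.
  apply: (card_le_inj k); first by move=> [a b] []; exact: kD.
  move=> [a b] [a' b'] /set_mem[/= ? ?] /set_mem[/= ? ?].
  by move=> /kinj[]// -> ->.
(* If the rest of [A] is no larger than [D G], then [A] embeds in the square of [D G], with [f 0]
   and [f 1] as tags for the two pieces. Otherwise [e] copies [D G] into the rest. *)
have [/card_le_fun[c cD cinj]|/card_le_fun[e eC einj]] :=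
    card_le_total (A `\` D G) (D G).
  have AD : (A #<= D G)%card.
    apply: (card_le_trans _ DDD).
    apply: (card_le_inj (fun x => if pselect (D G x) then (x, f 0%N) else (c x, f 1%N))).
      by move=> x Ax; case: pselect => Dx; split=> //=; exact: cD.
    move=> x y /set_mem Ax /set_mem Ay; case: pselect => Dx; case: pselect => Dy [].
    - by [].
    - by move=> _ /finj.
    - by move=> _ /finj.
    - by move=> /cinj; apply; rewrite inE.
  apply: (card_le_trans (card_le_setX AD AD)).
  by apply: (card_le_trans DDD); exact: subset_card_le.
exfalso.
have eA x : D G x -> A (e x) by move=> /eC[].
have eD x : D G x -> ~ D G (e x) by move=> /eC[].
have {}einj x y : D G x -> D G y -> e x = e y -> x = y.
  by move=> Dx Dy; apply: einj; rewrite inE.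
have kkD i x y : D G x -> D G y -> D G (k (k (x, y), f i)).
  by move=> Dx Dy; exact: (kD _ _ (kD _ _ Dx Dy) (fD i)).
(* The index [i] runs over the three new rectangles, and [f i] inside the value keeps their images
   apart. *)
pose pt (i : nat) x y := if i is 0 then (e x, y) else if i is 1 then (x, e y) else (e x, e y).
pose H p := exists i x y, [/\ (i < 3)%N, D G x, D G y &
  p = (pt i x y, e (k (k (x, y), f i)))].
have ptND i x y : D G x -> D G y -> ~ (D G (pt i x y).1 /\ D G (pt i x y).2).
  by move=> Dx Dy; case: i => [|[|i]] [/= D1 D2]; [exact: (eD x)|exact: (eD y)|exact: (eD x)].
have pt_inj i j x y x' y' : (i < 3)%N -> (j < 3)%N -> D G x -> D G y -> D G x' -> D G y' ->
    pt i x y = pt j x' y' -> [/\ i = j, x = x' & y = y'].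
  move=> i3 j3 Dx Dy Dx' Dy'.
  case: i i3 => [|[|[|i]]]// _; case: j j3 => [|[|[|j]]]// _ [] e1 e2; split=> //;
    try (by apply: einj); exfalso;
    first [by apply: (eD x) => //; rewrite e1|by apply: (eD y) => //; rewrite e2
    |by apply: (eD x') => //; rewrite -e1|by apply: (eD y') => //; rewrite -e2].
pose G' := G `|` H.
have GG' : G `<=` G' by exact: subsetUl.
have He x : D G x -> D G' (e x).
  by move=> Dx; exists (e (k (k (x, x), f 2%N))); right; exists 2%N, x, x.
have DG' x : D G x -> D G' x by move=> [t Gt]; exists t; left.
have D'P x : D G' x -> D G x \/ exists2 y, D G y & x = e y.
  move=> [t [Gt|[i [u [v [i3 Du Dv]]]]]]; first by left; exists t.
  rewrite /pt; case: i i3 => [|[|[|i]]]// _ /= [-> _ _].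
  - by right; exists u.
  - by left.
  - by right; exists u.
have G'D p : G p -> D G p.1.1 /\ D G p.1.2 /\ D G p.2.
  by case: p => [[a b] t] /Gdom[].
apply: (maxG G').
  split=> // G'G.
  have : G (pt 0 (f 0%N) (f 0%N), e (k (k (f 0%N, f 0%N), f 0%N))).
    by apply: G'G; right; exists 0%N, (f 0%N), (f 0%N).
  by move=> /G'D[+ _]; exact: eD.
split.
- move=> p q [Gp|[i [x [y [i3 Dx Dy ->]]]]] [Gq|[j [x' [y' [j3 Dx' Dy' ->]]]]].
  + exact: Ginj.
  + have [D1 [D2 D3]] := G'D _ Gp; split=> /= ee.
      by exfalso; rewrite ee in D1 D2; exact: (ptND j x' y').
    by exfalso; rewrite ee in D3; exact: (eD _ (kkD _ _ _ _ _) D3).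
  + have [D1 [D2 D3]] := G'D _ Gq; split=> /= ee.
      by exfalso; rewrite -ee in D1 D2; exact: (ptND i x y).
    by exfalso; rewrite -ee in D3; exact: (eD _ (kkD _ _ _ _ _) D3).
  + split=> /= [/pt_inj[]// -> -> ->//|/einj].
    move=> /(_ (kkD _ _ _ Dx Dy) (kkD _ _ _ Dx' Dy'))/kinj[]//; do ?exact: kD.
    by move=> /kinj[]// -> -> /finj ->.
- move=> a b t [/Gdom[Da Db Dt Aa]|[i [x [y [i3 Dx Dy]]]]].
    by split=> //; exact: DG'.
  have Dk : D G' (e (k (k (x, y), f i))) by exact/He/kkD.
  by case: i i3 Dk => [|[|[|i]]]// _ Dk [-> -> ->]; split=> //;
    do ?[exact: He|exact: DG'|exact: eA|exact: DA].
- move=> a b /D'P[Da|[x Dx ->]] /D'P[Db|[y Dy ->]].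
  + by have [t Gt] := Gtot _ _ Da Db; exists t; left.
  + by eexists; right; exists 1%N; do 2!eexists; split; last reflexivity.
  + by eexists; right; exists 0%N; do 2!eexists; split; last reflexivity.
  + by eexists; right; exists 2%N; do 2!eexists; split; last reflexivity.
- by move=> p _; exact: (subset_trans G0G).
Qed.

Lemma not_card_le_setX {T U : pointedType} {X : set T} {A : set U} : infinite_set X ->
  ~ (X #<= A)%card -> ~ (X #<= A `*` A)%card.
Proof.
move=> Xinf XA XAA.
have [Afin|Ainf] := pselect (finite_set A).
  exact/Xinf/(card_le_finite XAA)/finite_setX.
exact/XA/(card_le_trans XAA)/card_le_infinite_setX.
Qed.

(** Embed [X * X] in the union. If every row meets [A], then [X] embeds in [A]; otherwise some row,
    a copy of [X], lies in [B]. *)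
Lemma not_card_le_setU {T U : pointedType} {X : set T} {A B : set U} : infinite_set X ->
  ~ (X #<= A)%card -> ~ (X #<= B)%card -> ~ (X #<= A `|` B)%card.
Proof.
move=> Xinf XA XB XAB.
have /card_le_fun[f fAB finj] : (X `*` X #<= A `|` B)%card.
  exact: card_le_trans (card_le_infinite_setX _ Xinf) XAB.
have [fibA|] := pselect (forall x, X x -> exists2 y, X y & A (f (x, y))).
  apply: XA; apply: (card_le_rel (fun x u => exists2 y, X y & f (x, y) = u)).
    by move=> x /fibA[y Xy Af]; exists (f (x, y)) => //; exists y.
  move=> x x' u Xx Xx' [y Xy <-] [y' Xy' e].
  by have [] : (x', y') = (x, y) by apply: finj; rewrite ?inE.
move=> /existsNP[x /not_implyP[Xx /forall2NP fibA]].
apply: XB; apply: (card_le_inj (fun y => f (x, y))) => [y Xy|y y' /set_mem Xy /set_mem Xy' e].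
  by have [//|Af] := fibA y; have [||//] := fAB (x, y).
by have [] : (x, y) = (x, y') by apply: finj; rewrite ?inE.
Qed.

(** Well-order the line. If some initial segment is as large as the line, take the least [a] that
    bounds such a segment and pull the ordering back along an injection into it. *)
Lemma exists_initial_ordering (R : realType) :
  exists lt : R -> R -> Prop, initial_ordering lt.
Proof.
have [W Wwo] := wochoice.well_ordering_principle R.
have Wmin (A : set R) : A !=set0 -> exists2 z, A z & forall y, A y -> W z y.
  move=> [x Ax]; have [|z [[Az minz] _]] := Wwo (mem A).
    by exists x; exact: mem_set.
  by exists z => [|y Ay]; [exact: set_mem|apply: minz; exact: mem_set].
have Wrefl x : W x x.
  by have [|z -> ] := Wmin [set x]; [exists x|apply].
have Wanti x y : W x y -> W y x -> x = y.
  move=> xy yx; have [|z [_ uniqz]] := Wwo (mem [set x; y]).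
    by exists x; apply: mem_set; left.
  rewrite -(uniqz x) ?(uniqz y) //; split; rewrite ?inE /=; try (by [left|right]);
    by move=> u; rewrite inE => -[] ->.
have Wtotal x y : W x y \/ W y x.
  have [|z [] -> zmin] := Wmin [set x; y]; first by exists x; left.
    by left; apply: zmin; right.
  by right; apply: zmin; left.
have Wtrans x y z : W x y -> W y z -> W x z.
  move=> xy yz; have [|m mxyz mmin] := Wmin [set t | [\/ t = x, t = y | t = z]].
    by exists x; constructor 1.
  have Wmx := mmin x (Or31 _ _ erefl); have Wmy := mmin y (Or32 _ _ erefl).
  have Wmz := mmin z (Or33 _ _ erefl).
  case: mxyz => e; subst m => //.
    by rewrite (Wanti x y).
  by rewrite -(Wanti y z).
pose lt x y := W x y /\ x <> y.
have ltwf : well_founded lt.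
  move=> x; apply: contrapT => Nx.
  have [|z Nz zmin] := Wmin [set x | ~ Acc lt x]; first by exists x.
  apply: Nz; constructor => y [Wyz yz]; apply: contrapT => /zmin Wzy.
  exact/yz/Wanti.
have lttr x y z : lt x y -> lt y z -> lt x z.
  move=> [xy nxy] [yz nyz]; split; first exact: Wtrans yz.
  by move=> e; subst z; apply: nxy; exact: Wanti.
have lttot x y : x <> y -> lt x y \/ lt y x.
  by move=> xy; have [] := Wtotal x y; [left|right]; split=> // /esym.
have ltirr x : ~ lt x x by move=> [].
have [small|] := pselect (forall x, ~ ([set: R] #<= [set y | lt y x])%card).
  by exists lt; split=> //; split.
move=> /existsNP[x0 /contrapT Rx0].
have [|a /= /card_le_fun[f fa finj] amin] :=
  Wmin [set a | ([set: R] #<= [set y | lt y a])%card].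
  by exists x0.
have {}finj x y : f x = f y -> x = y by apply: finj; rewrite ?inE.
exists (fun x y => lt (f x) (f y)).
split=> [x|]; first exact: ltirr.
split=> [x y z|]; first exact: lttr.
split=> [x y xy|]; first by apply: lttot => /finj.
split=> [x|x Rx].
  have [u fx] : exists u, f x = u by exists (f x).
  elim/(well_founded_ind ltwf): u x fx => u IH x fx; constructor => y fyx.
  by apply: (IH (f y)) => //; rewrite -fx.
(* A large segment below [x] in the new ordering would embed in the segment below [f x], against the
   minimality of [a]. *)
have [Wfa fxa] := fa x I; apply: fxa; apply: Wanti => //; apply: amin.
apply: (card_le_trans Rx); apply: (card_le_inj f) => // y z _ _.
exact: finj.
Qed.

(** The value at [t] is chosen for the part of [f] below [t], extended by the default [point];
    locality of [P] makes the extension harmless. *)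
Lemma wf_choice {T : Type} {X : pointedType} {lt : T -> T -> Prop}
    (P : T -> (T -> X) -> X -> Prop) : well_founded lt ->
    (forall t f, exists x, P t f x) ->
    (forall t f g x, (forall s, lt s t -> f s = g s) -> P t f x -> P t g x) ->
  exists f : T -> X, forall t, P t f (f t).
Proof.
move=> wf exP Ploc.
have /choice[c cP] : forall tf : T * (T -> X), exists x, P tf.1 tf.2 x.
  by move=> [t f]; exact: exP.
pose ext t (h : forall s, lt s t -> X) s :=
  if pselect (lt s t) is left l then h s l else point.
pose F t (h : forall s, lt s t -> X) := c (t, ext t h).
exists (Fix wf _ F) => t; rewrite Fix_eq; last first.
  move=> x f g fg; congr (c (x, _)); apply/funext => s; rewrite /ext.
  by case: pselect.
apply: Ploc (cP (t, _)) => s st /=; rewrite /ext.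
by case: pselect.
Qed.

(** * Perfect subsets of Borel sets *)

(** This is the Suslin operation; no monotonicity of the scheme is imposed. *)
Definition suslin {T : Type} (F : seq nat -> set T) : set T :=
  [set x | exists s : nat -> nat, forall n, F (mkseq s n) x].

Definition analytic {T : topologicalType} (Z : set T) :=
  exists2 F : seq nat -> set T, (forall t, closed (F t)) & Z = suslin F.

Lemma closed_analytic {T : topologicalType} (Z : set T) : closed Z -> analytic Z.
Proof.
move=> cZ; exists (fun=> Z) => //; apply/seteqP; split=> x.
  by exists (fun=> 0%N).
by move=> [s /(_ 0%N)].
Qed.

Lemma mkseq_cons {T : Type} (f : nat -> T) n :
  mkseq f n.+1 = f 0%N :: mkseq (fun k => f k.+1) n.
Proof. by rewrite /mkseq /= -[1%N]addn0 iotaDl -map_comp. Qed.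

Lemma eq_in_mkseq {T : Type} (f g : nat -> T) n :
  (forall k, (k < n)%N -> f k = g k) -> mkseq f n = mkseq g n.
Proof.
elim: n => // n IH fg; rewrite !mkseqS IH ?fg // => k kn.
exact/fg/ltnW.
Qed.

(** The first digit of a witness names the index of the set, and the other digits witness membership
    in it. *)
Lemma analytic_bigcup {T : topologicalType} (Z : nat -> set T) :
  (forall i, analytic (Z i)) -> analytic (\bigcup_i Z i).
Proof.
move=> aZ; have /choice[F FP] : forall i, exists F : seq nat -> set T,
    (forall t, closed (F t)) /\ Z i = suslin F.
  by move=> i; have [F] := aZ i; exists F.
have cF i := (FP i).1; have ZE i := (FP i).2.
exists (fun t => if t is i :: t' then F i t' else setT).
  by case=> [|i t]; [exact: closedT|exact: cF].
apply/seteqP; split=> x.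
  move=> [i _]; rewrite ZE => -[s Fs].
  exists (fun k => if k is k'.+1 then s k' else i) => -[//|n].
  by rewrite mkseq_cons.
move=> [s Fs]; exists (s 0%N) => //; rewrite ZE.
by exists (fun k => s k.+1) => n; move: (Fs n.+1); rewrite mkseq_cons.
Qed.

(* The witness s of the intersection interleaves the witnesses of the Z i:
   the k-th digit of the i-th one is s (pickle (i, k)). *)
Lemma analytic_bigcap {T : topologicalType} (Z : nat -> set T) :
  (forall i, analytic (Z i)) -> analytic (\bigcap_i Z i).
Proof.
move=> aZ; have /choice[F FP] : forall i, exists F : seq nat -> set T,
    (forall t, closed (F t)) /\ Z i = suslin F.
  by move=> i; have [F] := aZ i; exists F.
have cF i := (FP i).1; have ZE i := (FP i).2.
(* A node [t] imposes just those conditions on prefixes whose digits can all be read off from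
   [t]. *)
exists (fun t => \bigcap_(p in [set p : nat * nat |
    forall k, (k < p.2)%N -> (pickle (p.1, k) < size t)%N])
  F p.1 (mkseq (fun k => nth 0%N t (pickle (p.1, k))) p.2)).
  by move=> t; apply: closed_bigI => p _; exact: cF.
apply/seteqP; split=> x.
  move=> Zx; have /choice[s sP] : forall i, exists s, forall n, F i (mkseq s n) x.
    by move=> i; have := Zx i I; rewrite ZE.
  exists (fun n => if unpickle n is Some p then s p.1 p.2 else 0%N) => n [i m] /=.
  rewrite size_mkseq => im.
  suff -> : mkseq (fun k => nth 0%N (mkseq (fun n => if unpickle n is Some p
      then s p.1 p.2 else 0%N) n) (pickle (i, k))) m = mkseq (s i) m by exact: sP.
  by apply: eq_in_mkseq => k /im ikn; rewrite nth_mkseq // pickleK.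
move=> [s Fs] i _; rewrite ZE; exists (fun k => s (pickle (i, k))) => m.
pose N := (\max_(k < m) pickle (i, nat_of_ord k)).+1.
have mN k : (k < m)%N -> (pickle (i, k) < N)%N.
  by move=> km; rewrite ltnS (leq_bigmax (Ordinal km)).
have {}Fs : F i (mkseq (fun k => nth 0%N (mkseq s N) (pickle (i, k))) m) x.
  by apply: (Fs N (i, m)) => k /mN; rewrite size_mkseq.
move: Fs.
suff -> : mkseq (fun k => nth 0%N (mkseq s N) (pickle (i, k))) m =
  mkseq (fun k => s (pickle (i, k))) m by [].
by apply: eq_in_mkseq => k /mN ikn; rewrite nth_mkseq.
Qed.

(** The sets that are analytic together with their complement form a sigma-algebra, and it contains
    the open rays that generate the Borel sets. *)
Lemma measurable_analytic {R : realType} (Z : set R) : measurable Z -> analytic Z.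
Proof.
move=> mZ; suff : [set Z : set R | analytic Z /\ analytic (~` Z)] Z by case.
have : (@measurable_realfun.RGenOInfty.G R).-sigma.-measurable Z.
  by rewrite -measurable_realfun.RGenOInfty.measurableE.
apply: smallest_sub => [|_ [x ->]].
  split=> /=.
  - by rewrite setC0; split; apply: closed_analytic; [exact: closed0|exact: closedT].
  - by move=> A [aA aAC]; rewrite setTD setCK.
  - move=> A aA; rewrite setC_bigcup; split.
      by apply: analytic_bigcup => i; case: (aA i).
    by apply: analytic_bigcap => i; case: (aA i).
split.
  rewrite itvoyEbigcup; apply: analytic_bigcup => k.
  by apply: closed_analytic; exact: rray_closed.
by rewrite setCitvr; apply: closed_analytic; exact: lray_closed.
Qed.

(** * Cantor schemes of rational intervals *)

Definition rat_itv (R : realType) (q : rat * rat) : set R :=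
  [set x | ratr q.1 <= x <= ratr q.2].

(* branch a n lists the first n digits of a with the last one first. *)
Fixpoint branch (a : nat -> bool) (n : nat) : seq bool :=
  if n is n'.+1 then a n' :: branch a n' else [::].

(** These code the perfect sets of the construction. Nothing is required of [w] here, so the set may
    also be small or empty. *)
Definition scheme_set (R : realType) (w : seq bool -> rat * rat) : set R :=
  [set x | exists a, forall n, rat_itv R (w (branch a n)) x].

Lemma branch_split (a b : nat -> bool) : a <> b ->
  exists n, branch a n = branch b n /\ a n != b n.
Proof.
move=> ab; have /existsNP[m /eqP abm] : ~ (forall m, a m = b m).
  by move=> E; apply: ab; apply/funext.
have exab : exists n, a n != b n by exists m.
exists (ex_minn exab); case: ex_minnP => n abn minn; split=> //.
have : (n <= n)%N by [].
elim: {-2}n => //= k IH kn; rewrite IH ?(ltnW kn) //; congr cons.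
by apply/eqP/negPn/negP => /minn; rewrite leqNgt kn.
Qed.

Lemma nested_intervals (R : realType) (p q : nat -> R) :
    (forall n, p n <= p n.+1) -> (forall n, q n.+1 <= q n) ->
    (forall n, p n <= q n) ->
  exists x, forall n, p n <= x <= q n.
Proof.
move=> pS qS pq.
have pmono m n : (m <= n)%N -> p m <= p n.
  by move=> /subnK <-; elim: (n - m)%N => // k /le_trans; apply; exact: pS.
have qmono m n : (m <= n)%N -> q n <= q m.
  by move=> /subnK <-; elim: (n - m)%N => // k; apply: le_trans; exact: qS.
have ub n : ubound (range p) (q n).
  move=> _ [m _ <-]; apply: (le_trans (pmono m _ (leq_maxl m n))).
  by apply: (le_trans (pq _)); exact/qmono/leq_maxr.
exists (sup (range p)) => n; apply/andP; split.
  by apply: ub_le_sup; [exists (q 0%N)|exists n].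
by apply: ge_sup; [exists (p 0%N), 0%N|exact: ub].
Qed.

(** Nested closed intervals give a point on every branch, and two branches lie in disjoint intervals
    just after their first difference. *)
Lemma card_le_scheme_set (R : realType) (w : seq bool -> rat * rat) :
    (forall s, rat_itv R (w s) !=set0) ->
    (forall s b, rat_itv R (w (b :: s)) `<=` rat_itv R (w s)) ->
    (forall s, rat_itv R (w (true :: s)) `&` rat_itv R (w (false :: s)) = set0) ->
  ([set: nat -> bool] #<= scheme_set R w)%card.
Proof.
move=> w0 wS wD.
apply: (card_le_rel (fun a x => forall n, rat_itv R (w (branch a n)) x)).
  move=> a _.
  have pq s : (ratr (w s).1 : R) <= ratr (w s).2.
    by have [x /andP[]] := w0 s; exact: le_trans.
  have [||//|x xP] := @nested_intervals R (fun n => ratr (w (branch a n)).1)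
    (fun n => ratr (w (branch a n)).2).
  - move=> n; have /= := wS (branch a n) (a n) (ratr (w (branch a n.+1)).1).
    by rewrite /rat_itv /= lexx pq => /(_ isT)/andP[].
  - move=> n; have /= := wS (branch a n) (a n) (ratr (w (branch a n.+1)).2).
    by rewrite /rat_itv /= lexx pq => /(_ isT)/andP[].
  by exists x => //; exists a.
move=> a b x _ _ ax bx; apply: contrapT => /branch_split[n [abn]].
have := ax n.+1; have := bx n.+1; rewrite /= abn.
case: (a n) (b n) => -[] //= h1 h2 _.
  by have : set0 x by rewrite -(wD (branch b n)).
by have : set0 x by rewrite -(wD (branch b n)).
Qed.

(** Fixing an interval together with the first digits of a witness lets a branch of the Cantor tree
    determine a whole witness in the limit. *)
Definition suslin_part (R : realType) (F : seq nat -> set R)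
    (v : rat * rat * seq nat) : set R :=
  [set x | rat_itv R v.1 x /\
    exists s, mkseq s (size v.2) = v.2 /\ forall n, F (mkseq s n) x].

Lemma rat_itv_around (R : realType) (q : rat * rat) (x d : R) :
  rat_itv R q x -> 0 < d -> exists p : rat * rat, [/\ rat_itv R p x,
    rat_itv R p `<=` rat_itv R q & rat_itv R p `<=` `]x - d, x + d[].
Proof.
move=> /andP[q1x xq2] d0.
have [|r] := @rat_in_itvoo R (x - d) x; first lra.
have [|r'] := @rat_in_itvoo R x (x + d); first lra.
rewrite !in_itv /= => /andP[xr' r'x] /andP[xr rx].
exists (Order.max q.1 r, Order.min q.2 r'); split.
- rewrite /rat_itv /=; apply/andP; split.
    by case: (leP q.1 r) => // _; exact: ltW.
  by case: (leP q.2 r') => // _; exact: ltW.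
- move=> y; rewrite /rat_itv /= => /andP[y1 y2]; apply/andP; split.
    by apply: le_trans y1; rewrite ler_rat le_max lexx.
  by apply: (le_trans y2); rewrite ler_rat ge_min lexx.
- move=> y; rewrite /rat_itv /= in_itv /= => /andP[y1 y2]; apply/andP; split.
    by apply: (lt_le_trans xr); apply: le_trans y1; rewrite ler_rat le_max lexx orbT.
  by apply: le_lt_trans r'x; apply: (le_trans y2); rewrite ler_rat ge_min lexx orbT.
Qed.

Lemma countable_bigcup_of_countable {T : Type} {I : countType} (A : I -> set T) :
  countable (\bigcup_(i in [set i | countable (A i)]) A i).
Proof. by apply: bigcup_countable => //; exact: countableP. Qed.

Lemma countable_setU {T : Type} (A B : set T) :
  countable A -> countable B -> countable (A `|` B).
Proof.
by move=> cA cB; rewrite -bigcup2E; apply: bigcup_countable => // -[|[|n]] _.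
Qed.

(** There are countably many nodes, so the union [U] of all countable parts is countable and the
    part of [v] has two points outside [U]. Around each, a smaller interval with one more digit of
    its witness has an uncountable part. *)
Lemma suslin_part_split (R : realType) (F : seq nat -> set R)
    (v : rat * rat * seq nat) (n : nat) :
    ~ countable (suslin_part R F v) ->
  exists c : bool -> rat * rat * seq nat,
    [/\ forall b, [/\ ~ countable (suslin_part R F (c b)),
           rat_itv R (c b).1 `<=` rat_itv R v.1,
           forall x y, rat_itv R (c b).1 x -> rat_itv R (c b).1 y ->
             `|x - y| < n.+1%:R^-1 &
           exists a, (c b).2 = rcons v.2 a] &
      rat_itv R (c true).1 `&` rat_itv R (c false).1 = set0].
Proof.
move=> vbig.
pose U := \bigcup_(u in [set u | countable (suslin_part R F u)]) suslin_part R F u.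
have Ucount : countable U by exact: countable_bigcup_of_countable.
have [x [y [[vx Ux] [vy Uy] xy]]] : exists x y, [/\ (suslin_part R F v `\` U) x,
    (suslin_part R F v `\` U) y & x < y].
  apply: contrapT => noxy; apply: vbig.
  have : countable ((suslin_part R F v `\` U) `|` U).
    apply: countable_setU => //.
    have [[x Yx]|/forallNP Y0] := pselect (exists x, (suslin_part R F v `\` U) x).
      apply: (sub_countable _ (countable1 x)); apply: subset_card_le => y Yy.
      apply/eqP; case: (ltgtP y x) => // ne; case: noxy; first by exists y, x.
      by exists x, y.
    by apply: (sub_countable _ (countable0 R)); apply: subset_card_le => y /Y0.
  apply: sub_countable; apply: subset_card_le => z vz.
  by have [Uz|Uz] := pselect (U z); [right|left].
have e0 : (0 : R) < n.+1%:R^-1 by rewrite invr_gt0.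
(* The second bound on [d] makes the new intervals short, the third makes them disjoint. *)
have [d [d0 dn dxy]] : exists d : R, [/\ 0 < d, d + d <= n.+1%:R^-1 & x + d <= y - d].
  move: n.+1%:R^-1 e0 => e e0; have [le|/ltW le] := leP e (y - x).
    by exists (e / 2); split; lra.
  by exists ((y - x) / 2); split; lra.
have child z : suslin_part R F v z -> ~ U z -> exists u : rat * rat * seq nat,
    [/\ ~ countable (suslin_part R F u), rat_itv R u.1 `<=` rat_itv R v.1,
      rat_itv R u.1 `<=` `]z - d, z + d[ & exists a, u.2 = rcons v.2 a].
  move=> [vz [s [sv Fs]]] Uz.
  have [p [pz pv pd]] := rat_itv_around R v.1 z d vz d0.
  exists (p, mkseq s (size v.2).+1); split=> //; last first.
    by exists (s (size v.2)); rewrite [LHS]mkseqS sv.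
  move=> cp; apply: Uz; exists (p, mkseq s (size v.2).+1) => //.
  by split=> //; exists s; rewrite size_mkseq.
have [cx [cx1 cx2 cx3 cx4]] := child x vx Ux.
have [cy [cy1 cy2 cy3 cy4]] := child y vy Uy.
exists (fun b => if b then cx else cy); split.
  move: n.+1%:R^-1 dn {e0} => e dn.
  have diam z (u : set R) : u `<=` `]z - d, z + d[ ->
      forall t t', u t -> u t' -> `|t - t'| < e.
    move=> ud t t' /ud/=; rewrite in_itv /= => /andP[? ?] /ud/=.
    by rewrite in_itv /= ltr_norml => /andP[? ?]; apply/andP; split; lra.
  by case; split=> //; [exact: (diam x)|exact: (diam y)].
apply/seteqP; split=> // z [/cx3 + /cy3]; rewrite /= !in_itv /=.
by move=> /andP[? ?] /andP[? ?]; lra.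
Qed.

(** The perfect set theorem for analytic sets, by iterating the splitting of uncountable parts. The
    digits met along a branch form a witness for its point, because the sets [F] are closed. *)
Lemma scheme_of_uncountable_analytic (R : realType) (Z : set R) :
    analytic Z -> ~ countable Z ->
  exists2 w : seq bool -> rat * rat,
    scheme_set R w `<=` Z & ([set: nat -> bool] #<= scheme_set R w)%card.
Proof.
move=> [F cF ->] Zbig.
have [q0 q0big] : exists q, ~ countable (suslin_part R F (q, [::])).
  apply: contrapT => /forallNP small; apply: Zbig.
  have := @countable_bigcup_of_countable R _ (fun q => suslin_part R F (q, [::])).
  apply: sub_countable; apply: subset_card_le => x [s Fs].
  have [|p] := @rat_in_itvoo R (x - 1) x; first lra.
  have [|q] := @rat_in_itvoo R x (x + 1); first lra.
  rewrite !in_itv /= => /andP[xq _] /andP[_ px].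
  exists (p, q); first by apply: contrapT; exact: small.
  by split; [rewrite /rat_itv /= !ltW|exists s].
have /choice[c cP] : forall vn : (rat * rat * seq nat) * nat,
    exists c : bool -> rat * rat * seq nat,
    ~ countable (suslin_part R F vn.1) ->
    [/\ forall b, [/\ ~ countable (suslin_part R F (c b)),
           rat_itv R (c b).1 `<=` rat_itv R vn.1.1,
           forall x y, rat_itv R (c b).1 x -> rat_itv R (c b).1 y ->
             `|x - y| < vn.2.+1%:R^-1 &
           exists a, (c b).2 = rcons vn.1.2 a] &
      rat_itv R (c true).1 `&` rat_itv R (c false).1 = set0].
  move=> [v n] /=.
  have [/(suslin_part_split R F v n)[c cP]|small] :=
      pselect (~ countable (suslin_part R F v)).
    by exists c.
  by exists (fun=> v).
(* The depth [size s'] is the precision of the split, so the intervals shrink to length 0 along a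
   branch. *)
pose node := fix node (s : seq bool) :=
  if s is b :: s' then c (node s', size s') b else (q0, [::]).
have big s : ~ countable (suslin_part R F (node s)).
  by elim: s => [//|b s IH] /=; have [/(_ b)[]] := cP (node s, size s) IH.
have splitP s := cP (node s, size s) (big s).
have part0 s : suslin_part R F (node s) !=set0.
  by apply: contrapT => /nonemptyPn s0; apply: (big s); rewrite s0.
have Psz a n : size (node (branch a n)).2 = n /\ size (branch a n) = n.
  elim: n => [//|n [IH1 IH2]] /=; split; last by rewrite IH2.
  have [/(_ (a n))[_ _ _ [t ->]] _] := splitP (branch a n).
  by rewrite size_rcons IH1.
exists (fun s => (node s).1); last first.
  apply: card_le_scheme_set => [s|s b|s].
  - by have [x []] := part0 s; exists x.
  - by have [/(_ b)[]] := splitP s.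
  - by have [] := splitP s.
move=> x [a xa].
pose t k := nth 0%N (node (branch a k.+1)).2 k.
have tE n : mkseq t n = (node (branch a n)).2.
  elim: n => [//|n IH]; rewrite mkseqS IH /t /=.
  have [/(_ (a n))[_ _ _ [u ->]] _] := splitP (branch a n).
  by rewrite /= nth_rcons (Psz a n).1 ltnn eqxx.
exists t => n; apply: contrapT => /=; rewrite tE => nFx.
have oF : open (~` F (node (branch a n)).2) by exact/closed_openC/cF.
have /nbhs_ballP[e /= e0 eF] := open_nbhs_nbhs (conj oF nFx).
have [k] := ltr_add_invr e0; rewrite add0r => ke.
(* Beyond depth [n] the first [n] digits are fixed, and beyond [k] the intervals are shorter than
   [e]. So a point [y] of the part at depth [m.+1] lies in the ball around [x] and in the closed set
   that the ball misses. *)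
pose m := maxn n k.
have [y [ym [s [sm Fy]]]] := part0 (branch a m.+1).
apply: (eF y).
  rewrite /ball /=.
  have [/(_ (a m))[_ _ + _] _] := splitP (branch a m).
  move=> /(_ x y (xa m.+1) ym) /=; rewrite (Psz a m).2 => /lt_trans; apply.
  apply: le_lt_trans ke; rewrite lef_pV2 ?posrE // ler_nat ltnS.
  exact: leq_maxr.
have -> : (node (branch a n)).2 = mkseq s n; last exact: Fy.
have : take n (mkseq s m.+1) = take n (mkseq t m.+1).
  by rewrite tE; congr take; rewrite -[RHS]sm (Psz a m.+1).1.
rewrite -!map_take take_iota (minn_idPl _) ?leqW ?leq_maxl //.
by move=> st; rewrite -tE; exact: esym st.
Qed.

(** * The transfinite construction *)

(** Countable sets are Lebesgue null, while the unit interval has measure 1. *)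
Lemma uncountable_real (R : realType) : ~ countable [set: R].
Proof.
move=> cR; have : countable `[0 : R, 1].
  by apply: sub_countable cR; exact: subset_card_le.
move=> /countable_lebesgue_measure0; rewrite lebesgue_measure_itv /= lte01.
by rewrite oppr0 adde0 => /eqP; rewrite eqe oner_eq0.
Qed.

Lemma ratr_lt_inj (R : realType) (x y : R) :
  (forall q : rat, (ratr q < x) = (ratr q < y)) -> x = y.
Proof.
move=> xy; apply/eqP; case: (ltgtP x y) => // lt.
  have [q] := rat_in_itvoo lt; rewrite in_itv /= => /andP[xq].
  by rewrite -xy ltNge (ltW xq).
have [q] := rat_in_itvoo lt; rewrite in_itv /= => /andP[yq].
by rewrite xy ltNge (ltW yq).
Qed.

(** Bits record the rational Dedekind cuts of the two reals and the graph of the scheme; together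
    they have a countable index type. *)
Lemma card_le_codes (R : realType) :
  ([set: R * (seq bool -> rat * rat) * R] #<= [set: nat -> bool])%card.
Proof.
pose code (p : R * (seq bool -> rat * rat) * R)
    (u : rat + (seq bool * (rat * rat)) + rat) : bool :=
  match u with
  | inl (inl q) => ratr q < p.1.1
  | inl (inr (s, q)) => p.1.2 s == q
  | inr q => ratr q < p.2
  end.
apply: (card_le_inj (fun p n => if unpickle n is Some u then code p u else false)) => //.
move=> [[x w] y] [[x' w'] y'] _ _ E.
have {}E u : code (x, w, y) u = code (x', w', y') u.
  by have := congr1 (fun h => h (pickle u)) E; rewrite /= pickleK.
congr (_, _, _).
- by apply: ratr_lt_inj => q; exact: (E (inl (inl q))).
- by apply/funext => s; have := E (inl (inr (s, w' s))); rewrite /= eqxx => /eqP.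
- by apply: ratr_lt_inj => q; exact: (E (inr q)).
Qed.

Lemma card_le_real_scheme_set (R : realType) (Z : set R) :
    measurable Z -> ~ countable Z ->
  exists2 w, scheme_set R w `<=` Z & ([set: R] #<= scheme_set R w)%card.
Proof.
move=> /measurable_analytic/scheme_of_uncountable_analytic/[apply] -[w wZ wc].
exists w => //; apply: card_le_trans wc; apply: card_le_trans (card_le_codes R).
apply: (card_le_inj (fun x => (x, fun=> (0, 0), 0))) => // x y _ _ [].
by [].
Qed.

(** Invert an injection of triples into the line and forget the third coordinate, a spare real that
    gives each pair continuum many stages. *)
Lemma exists_cofinal_schedule (R : realType) :
  exists e : R -> R * (seq bool -> rat * rat),
    (forall t, ([set: R] #<= [set g | e g = t])%card).
Proof.
have /card_le_fun[g _ ginj] : ([set: R * (seq bool -> rat * rat) * R] #<= [set: R])%card.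
  apply: (card_le_trans (card_le_codes R)).
  have [|w _ wR] := scheme_of_uncountable_analytic R setT _ (@uncountable_real R).
    exact/closed_analytic/closedT.
  by apply: (card_le_trans wR); exact: subset_card_le.
have {}ginj p p' : g p = g p' -> p = p' by apply: ginj; rewrite inE.
have /choice[e eP] : forall x, exists p, forall p', g p' = x -> p' = p.
  move=> x; have [[p <-]|no] := pselect (exists p, g p = x).
    by exists p => p' /ginj.
  by exists (0, fun=> (0, 0), 0) => p gp; exfalso; apply: no; exists p.
exists (fun x => (e x).1) => t.
apply: (card_le_inj (fun r => g (t, r))) => [r _|r r' _ _ /ginj[]//].
by rewrite /= -(eP _ (t, r) erefl).
Qed.

(** * The stages of the recursion *)

(** The pair [f g] holds the translation of the segment below [g], then the point of the perfect
    set. *)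
Definition claims (R : realType) (lt : R -> R -> Prop) (f : R -> R * R) (g t : R) : Prop :=
  t = (f g).2 \/ exists2 v, lt v g & t = v + (f g).1.

Definition claimed_before (R : realType) (lt : R -> R -> Prop) (f : R -> R * R)
    (g : R) : set R :=
  [set t | exists2 d, lt d g & claims R lt f d t].

(** With [I] the segment below [g], the claimed points are covered by an image of [I] and an image
    of [I * I]. *)
Lemma claimed_before_small (R : realType) (lt : R -> R -> Prop) (f : R -> R * R) (g : R) :
  infinite_set [set: R] -> initial_ordering lt ->
  ~ ([set: R] #<= claimed_before R lt f g)%card.
Proof.
move=> Rinf [_ [lttr [_ [_ small]]]].
pose I := [set y | lt y g].
have subV : claimed_before R lt f g `<=`
    (fun d => (f d).2) @` I `|` (fun p => p.1 + (f p.2).1) @` (I `*` I).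
  move=> t [d dg [->|[v vd ->]]]; [by left; exists d|right; exists (v, d) => //].
  by split=> //=; exact: lttr vd dg.
move=> /card_le_trans/(_ (subset_card_le subV)); apply: not_card_le_setU => //.
  by move=> /card_le_trans/(_ (card_image_le _ _)); exact: small.
move=> /card_le_trans/(_ (card_image_le _ _)).
exact: not_card_le_setX (small g).
Qed.

Lemma exists_disjoint_claims (R : realType) (lt : R -> R -> Prop) (K : R -> set R) :
    infinite_set [set: R] -> initial_ordering lt ->
    (forall g, ([set: R] #<= K g)%card) ->
  exists f : R -> R * R, (forall g, K g (f g).2) /\
    forall g g' t, claims R lt f g t -> claims R lt f g' t -> g = g'.
Proof.
move=> Rinf ltI KR; have [_ [lttr [lttot [ltwf small]]]] := ltI.
pose V := claimed_before R lt.
pose P g f (p : R * R) := [/\ forall y, lt y g -> ~ V f g (y + p.1), K g p.2,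
  ~ V f g p.2 & forall v, lt v g -> p.2 <> v + p.1].
have [| |f fP] := @wf_choice R (R * R)%type lt P ltwf.
- move=> g f.
  have Vsmall : ~ ([set: R] #<= V f g)%card by exact: claimed_before_small.
  pose I := [set y | lt y g].
  have VIsmall : ~ ([set: R] #<= V f g `|` I)%card.
    exact: not_card_le_setU Rinf Vsmall (small g).
  (* A forbidden translation is the difference of a claimed point and a point of [I], hence an image
     of a pair from the square of [V f g] united with [I]. *)
  have [x xP] : exists x, forall y, lt y g -> ~ V f g (y + x).
    apply: contrapT => nox.
    apply: (not_card_le_setX Rinf VIsmall).
    apply: (card_le_trans _ (card_image_le (fun p => p.1 - p.2) _)).
    apply: subset_card_le => x _; apply: contrapT => nx; apply: nox; exists x => y yg Vyx.
    apply: nx; exists (y + x, y) => /=; first by split; [left|right].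
    by rewrite addrAC subrr add0r.
  have [z Kz zP] : exists2 z, K g z & ~ (V f g `|` (fun v => v + x) @` I) z.
    apply: contrapT => noz.
    have : ~ ([set: R] #<= V f g `|` (fun v => v + x) @` I)%card.
      apply: not_card_le_setU => //.
      by move=> /card_le_trans/(_ (card_image_le _ _)); exact: small.
    apply; apply: (card_le_trans (KR g)); apply: subset_card_le => z Kz.
    by apply: contrapT => nz; apply: noz; exists z.
  exists (x, z); split=> //= [Vz|v vg zv]; apply: zP; first by left.
  by right; exists v.
- move=> g f f' p ff'.
  have VE : V f g = V f' g.
    by apply/seteqP; split=> t [d dg td]; exists d => //; move: td;
      rewrite /claims (ff' d dg).
  by rewrite /P VE.
have lt_neq g g' t : lt g' g -> claims R lt f g t -> claims R lt f g' t -> False.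
  move=> g'g gt g't; have [xP _ zV _] := fP g.
  have Vt : V f g t by exists g'.
  by case: gt Vt => [->//|[v vg ->]]; exact: xP.
exists f; split=> [g|g g' t gt g't]; first by have [] := fP g.
apply: contrapT => /lttot[gg'|gg'].
  exact: lt_neq gg' g't gt.
exact: lt_neq gg' gt g't.
Qed.

(* The index set {xi < c} is represented by R itself (|R| = c). *)
Theorem mainTheorem6 (R : realType) :
  exists B : R -> set R,
    (forall x : R, exists! xi : R, B xi x) /\
    (forall xi : R, Bernstein (B xi) /\ lt_cf_covering (B xi)).
Proof.
have Rinf : infinite_set [set: R].
  by move=> /finite_set_countable; exact: uncountable_real.
have [lt ltI] := exists_initial_ordering R.
have [e eR] := exists_cofinal_schedule R.
have [_ [lttr [lttot [_ small]]]] := ltI.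
(* Falling back to the whole line when the scheme is small leaves every stage a large set to choose
   from. *)
pose K g : set R := let w := (e g).2 in
  if pselect ([set: R] #<= scheme_set R w)%card is left _ then scheme_set R w else setT.
have KR g : ([set: R] #<= K g)%card.
  by rewrite /K; case: pselect.
have [f [fK claim_inj]] := exists_disjoint_claims R lt K Rinf ltI KR.
(* Claims of distinct stages are disjoint, so the owner of a claimed point is well defined;
   unclaimed points get an arbitrary one. *)
have /choice[owner ownerP] : forall t, exists xi, forall g, claims R lt f g t -> xi = (e g).1.
  move=> t; have [[g gt]|no] := pselect (exists g, claims R lt f g t).
    by exists (e g).1 => g' /(claim_inj _ _ _ gt) ->.
  by exists 0 => g gt; exfalso; apply: no; exists g.
exists (fun xi => [set t | owner t = xi]); split=> [x|xi].
  by exists (owner x).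
have meets Z eta : measurable Z -> ~ countable Z -> exists2 z, Z z & owner z = eta.
  move=> mZ cZ; have [w wZ wR] := card_le_real_scheme_set R Z mZ cZ.
  have [g eg] : exists g, e g = (eta, w).
    have /card_le_fun[h hP _] := eR (eta, w).
    by exists (h 0); exact: hP.
  exists (f g).2; last by rewrite (ownerP _ g) ?eg //; left.
  by apply: wZ; have := fK g; rewrite /K eg /=; case: pselect.
split=> [Z mZ cZ|A Acf].
  (* A point of [Z] in the different block [xi + 1] lies outside the block [xi]. *)
  have [z Zz oz] := meets Z xi mZ cZ; have [z' Zz' oz'] := meets Z (xi + 1) mZ cZ.
  split; [by exists z|exists z'; split=> // /=].
  rewrite oz' => /eqP; rewrite -subr_eq0 addrAC subrr add0r.
  by rewrite oner_eq0.
(* A set of size below the cofinality is bounded by some [a]. Continuum many stages serve [xi] and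
   fewer precede [a], so some such stage [g] is not before [a], and its translated segment covers a
   translate of [A]. *)
have [a Aa] := Acf lt ltI A (card_lexx A).
have [w _ wR] := card_le_real_scheme_set R setT measurableT (@uncountable_real R).
have [g eg ga] : exists2 g, (e g).1 = xi & ~ lt g a.
  apply: contrapT => nog; apply: (small a); apply: (card_le_trans (eR (xi, w))).
  apply: subset_card_le => g /= eg; apply: contrapT => ga; apply: nog.
  by exists g => //; rewrite eg.
exists (f g).1 => _ [b /Aa ba <-] /=; rewrite (ownerP _ g) //; right.
exists b => //; have [->//|/eqP/lttot[]//] := eqVneq g a.
exact: lttr.
Qed.
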